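(* Let $m$ be a positive integer, let $\alpha=(\alpha_{k+m})_{k\in\mathbb N}$ be a sequence of commuting indeterminates, and let $\Lambda^{(m)}=\left(\lambda^{(m)}_{i,j}\right)_{i,j\in\mathbb N}$ be the upper-triangular matrix such that $\lambda^{(m)}_{i,j}$ is the generating polynomial of the partial $m$-Dyck paths from $(0,(m+1)i)$ to $(j,j)$. Then $\Lambda^{(m)}$ is totally positive in the polynomial ring $\mathbb Z[\alpha]$ equipped with the coefficient-wise partial order.
   Context: $\mathbb N=\{0,1,2,\dots\}$. For a positive integer $m$, a partial $m$-Dyck path is a finite path in $\mathbb N\times\mathbb N$ using steps $(1,1)$ (rises) and $(1,-m)$ ($m$-falls), allowed to start and end anywhere in $\mathbb N\times\mathbb N$. Given a sequence $\alpha=(\alpha_i)_{i\ge m}$, each rise gets weight $1$ and each $m$-fall from height $i$ gets weight $\alpha_i$; the weight of a path is the product of the weights of its steps, and the generating polynomial of a finite set of paths is the sum of their weights. Explicitly, $\lambda^{(m)}_{i,j}=0$ for $i>j$, $\lambda^{(m)}_{0,j}=1$, and $\lambda^{(m)}_{i,j}=\sum_{j\geq\ell_1\geq\cdots\geq\ell_i\geq i}\prod_{k=1}^{i}\alpha_{km+\ell_k}$ for $1\le i\le j$. In the coefficient-wise partial order, an element of $\mathbb Z[\alpha]$ is nonnegative if all its coefficients are nonnegative. A (possibly infinite) matrix with entries in $\mathbb Z[\alpha]$ is totally positive (for this order) if all its finite minors are nonnegative, i.e. are polynomials with nonnegative coefficients. *)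

(* Defs.v *)
From mathcomp Require Import all_boot all_order all_algebra.
From mathcomp Require Import zify.
From mathcomp Require Export finmap.
From mathcomp Require Export monalg.

Set Implicit Arguments.
Unset Strict Implicit.
Unset Printing Implicit Defensive.

Import GRing.Theory Num.Theory.
Local Open Scope ring_scope.

(* Z[alpha]: polynomials with integer coefficients in infinitely many commuting
   indeterminates indexed by k : nat. The k-th indeterminate stands for
   alpha_(k+m), so alpha_i is the indeterminate of index i - m. *)
Notation Zalpha := {malg int[{cmonom nat}]}.

(* Only meaningful for m <= i, which always holds when an m-fall starts at
   height i. *)
Definition alpha (m i : nat) : Zalpha := << ucm (i - m)%N >>.

Definition coefwise_nonneg (p : Zalpha) : Prop :=
  forall u : {cmonom nat}, 0 <= p@_u.

Definition totally_positive (A : nat -> nat -> Zalpha) : Prop :=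
  forall (n : nat) (r c : 'I_n -> nat),
    {homo r : a b / (a < b)%N} -> {homo c : a b / (a < b)%N} ->
    coefwise_nonneg (\det (\matrix_(a < n, b < n) A (r a) (c b))).

Section PartialDyckPaths.
Variable m : nat.

Definition point : Type := (nat * nat)%type.

Definition rise : rel point :=
  fun p q => (q.1 == p.1.+1) && (q.2 == p.2.+1).

(* The step (1, -m), without truncated subtraction: it requires m <= p.2. *)
Definition mfall : rel point :=
  fun p q => (q.1 == p.1.+1) && (p.2 == q.2 + m)%N.

(* A partial m-Dyck path is given by its starting point [p] and the sequence
   [s] of its subsequent vertices. *)
Definition mDyck (p : point) (s : seq point) : bool :=
  path (fun u v => rise u v || mfall u v) p s.

Definition mstep_weight (p q : point) : Zalpha :=
  if mfall p q then alpha m p.2 else 1.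

Fixpoint mDyck_weight (p : point) (s : seq point) : Zalpha :=
  if s is q :: s' then mstep_weight p q * mDyck_weight q s' else 1.

(* A superset of the partial m-Dyck paths with n steps starting at p. *)
Fixpoint candidates (n : nat) (p : point) : seq (seq point) :=
  if n is n'.+1 then
    let up := (p.1.+1, p.2.+1) in
    let down := (p.1.+1, p.2 - m)%N in
    [seq up :: s | s <- candidates n' up] ++
    [seq down :: s | s <- candidates n' down]
  else [:: [::]].

Definition mDyck_paths (p q : point) : {fset seq point} :=
  [fset s in candidates (q.1 - p.1) p | mDyck p s && (last p s == q)]%fset.

Lemma mDyck_size p s : mDyck p s -> (last p s).1 = (p.1 + size s)%N.
Proof.
elim: s p => [|q s IHs] p /=; first by rewrite addn0.
case/andP=> pq /IHs ->; rewrite addnS -addSn; congr (_ + _)%N.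
by case/orP: pq => /andP[/eqP].
Qed.

Lemma mDyck_candidates p s : mDyck p s -> s \in candidates (size s) p.
Proof.
elim: s p => //= -[q1 q2] s IHs [p1 p2] /= /andP[pq /IHs s_in].
rewrite mem_cat; move: s_in; case/orP: pq => /andP[/= /eqP -> /eqP ->] s_in.
  by rewrite map_f.
by rewrite addnK orbC map_f.
Qed.

(* [mDyck_paths p q] is exactly the set of partial m-Dyck paths from p to q. *)
Lemma mDyck_pathsP p q s :
  (s \in mDyck_paths p q) = mDyck p s && (last p s == q).
Proof.
rewrite !inE /=; case: (boolP (mDyck p s && _)); last by rewrite andbF.
move=> /andP[ps /eqP <-]; rewrite andbT (mDyck_size ps) addKn.
exact: mDyck_candidates.
Qed.

Definition gen_poly (p : point) (S : {fset seq point}) : Zalpha :=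
  \sum_(s <- S) mDyck_weight p s.

Definition Lambda (i j : nat) : Zalpha :=
  let p := (0%N, (m.+1 * i)%N) in gen_poly p (mDyck_paths p (j, j)).

Lemma mDyck_height p s : mDyck p s ->
  (p.2 + size s <= (last p s).2 + m.+1 * size s)%N.
Proof.
elim: s p => [|q s IHs] p /=; first by rewrite muln0 !addn0.
case/andP=> pq /IHs; rewrite mulnS.
by case/orP: pq => /andP[_ /eqP ->]; lia.
Qed.

Lemma Lambda_upper_triangular i j : (j < i)%N -> Lambda i j = 0.
Proof.
move=> lt_ji; rewrite /Lambda /gen_poly big_seq big1 // => s.
rewrite mDyck_pathsP => /andP[ps /eqP lastE].
have := mDyck_height ps; have := mDyck_size ps.
rewrite lastE /= add0n => <-; rewrite addnC leq_add2l.
by rewrite leq_pmul2l // leqNgt lt_ji.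
Qed.

End PartialDyckPaths.

(* Main.v *)
(* At abscissa s, the paths considered have height s + (m + 1) i for a level i,
   which a rise preserves and an m-fall decrements. Splitting
   off the first step shows that the path matrix L_s starting at abscissa s has
   first column e_0, while its other columns form B_s L_(s+1), with B_s lower
   bidiagonal with nonnegative entries. Minors are then nonnegative by induction
   on the largest column index: a minor through column 0 is expanded along it,
   the others are minors of B_s L_(s+1). *)
Require Import Defs.
From mathcomp Require Import all_boot all_order all_algebra.
From mathcomp Require Import zify.

Set Implicit Arguments.
Unset Strict Implicit.
Unset Printing Implicit Defensive.

Import GRing.Theory Num.Theory.
Local Open Scope ring_scope.

Lemma coefwise_nonneg0 : coefwise_nonneg 0.
Proof. by move=> u; rewrite mcoeff0. Qed.

Lemma coefwise_nonnegU (c : int) (k : {cmonom nat}) :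
  0 <= c -> coefwise_nonneg << c *g k >>.
Proof. by move=> c_ge0 u; rewrite mcoeffU mulrn_wge0. Qed.

Lemma coefwise_nonneg_nat (n : nat) : coefwise_nonneg n%:R.
Proof.
by rewrite -(mul1r n%:R) mulr_natr => u; rewrite mcoeffMn mcoeff1 !mulrn_wge0.
Qed.

Lemma coefwise_nonnegD (p q : Zalpha) :
  coefwise_nonneg p -> coefwise_nonneg q -> coefwise_nonneg (p + q).
Proof. by move=> p_ge0 q_ge0 u; rewrite mcoeffD addr_ge0. Qed.

Lemma coefwise_nonnegM (p q : Zalpha) :
  coefwise_nonneg p -> coefwise_nonneg q -> coefwise_nonneg (p * q).
Proof.
move=> p_ge0 q_ge0 u; rewrite malgME raddf_sum sumr_ge0 // => k1 _.
rewrite raddf_sum sumr_ge0 // => k2 _.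
by rewrite coefwise_nonnegU // mulr_ge0.
Qed.

Lemma coefwise_nonneg_alpha (m i : nat) : coefwise_nonneg (alpha m i).
Proof. exact: coefwise_nonnegU. Qed.

Lemma candidates_uniq (m n : nat) (p : point) : uniq (candidates m n p).
Proof.
elim: n p => //= n IHn p; rewrite cat_uniq !map_inj_uniq ?IHn //=;
  try by move=> s t [].
rewrite andbT; apply/hasPn => _ /mapP[s _ ->]; apply/mapP => -[t _ []]; lia.
Qed.

Definition path_sum (m n : nat) (p q : point) : Zalpha :=
  \sum_(s <- candidates m n p | mDyck m p s && (last p s == q))
    mDyck_weight m p s.

(** Each step advances the abscissa by one, so every path from [p] to [q] has exactly [n] steps and
    is listed once among the candidates. *)
Lemma gen_poly_path_sum (m n : nat) (p q : point) : q.1 = (p.1 + n)%N ->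
  gen_poly m p (mDyck_paths m p q) = path_sum m n p q.
Proof.
move=> qE; rewrite /gen_poly /path_sum -[RHS]big_filter; apply: perm_big.
apply: uniq_perm; rewrite ?fset_uniq ?filter_uniq ?candidates_uniq // => s.
rewrite mDyck_pathsP mem_filter; case: (boolP (mDyck m p s && _)) => //=.
case/andP=> ps /eqP lastE; have := mDyck_size ps; rewrite lastE qE.
by move/addnI ->; rewrite mDyck_candidates.
Qed.

Lemma path_sumS (m n : nat) (p q : point) :
  path_sum m n.+1 p q = path_sum m n (p.1.+1, p.2.+1) q
    + (if (m <= p.2)%N
       then alpha m p.2 * path_sum m n (p.1.+1, p.2 - m)%N q else 0).
Proof.
rewrite /path_sum /= big_cat !big_map /=; congr (_ + _).
  apply: eq_big => s; first by rewrite /rise !eqxx.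
  by rewrite /mstep_weight /mfall /=; case: ifP => [/andP[_ /eqP]|_ _];
    [lia | rewrite mul1r].
case: leqP => [m_le|m_gt].
  rewrite big_distrr; apply: eq_big => s /=.
    by rewrite /mfall /= eqxx subnK // eqxx orbT.
  move=> _; congr (_ * _).
  by rewrite /mstep_weight /mfall /= subnK // !eqxx.
(* For [p.2 < m] the truncated candidate lands at height 0, which is neither an m-fall nor a rise,
   so this branch carries no path. *)
rewrite big1 // => s /andP[/andP[+ _] _].
by rewrite /rise /mfall /= => /orP[]/andP[_ /eqP]; lia.
Qed.

(** A step gains at most one unit of height. *)
Lemma path_sum_eq0 (m n : nat) (p q : point) :
  (p.2 + n < q.2)%N -> path_sum m n p q = 0.
Proof.
elim: n p => [|n IHn] p lt_pq.
  rewrite /path_sum big_seq_cond big1 // => s; rewrite inE.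
  by case/andP=> /eqP -> /= /eqP pq; rewrite pq addn0 ltnn in lt_pq.
by rewrite path_sumS !IHn /= ?mulr0 ?if_same ?addr0 //; lia.
Qed.

(** Entry [(i, j)] of the matrix L_s: [j] steps remain, of which exactly [i] are m-falls. *)
Fixpoint level_sum (m s i j : nat) : Zalpha :=
  if j is j'.+1 then
    level_sum m s.+1 i j' +
      (if i is i'.+1 then alpha m (s + m.+1 * i) * level_sum m s.+1 i' j' else 0)
  else (i == 0%N)%:R.

Lemma path_sum_level (m s i j : nat) :
  path_sum m j (s, s + m.+1 * i)%N (s + j, s + j)%N = level_sum m s i j.
Proof.
elim: j s i => [|j IHj] s i.
  rewrite /path_sum big_mkcond big_seq1 /= !addn0 xpair_eqE eqxx /=.
  by rewrite -[X in _ == X]addn0 eqn_add2l muln_eq0 /=; case: eqP.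
rewrite path_sumS /= !addnS -!addSn; congr (_ + _).
  by rewrite -IHj.
case: i => [|i].
  rewrite muln0 addn0; case: ifP => // m_le.
  (* After an m-fall from level 0, even a run of rises ends below the target. *)
  by rewrite path_sum_eq0 ?mulr0 //=; lia.
have -> : (m <= s + m.+1 * i.+1)%N by lia.
rewrite -IHj; congr (_ * path_sum _ _ (_, _) _); lia.
Qed.

Lemma Lambda_level_sum (m i j : nat) : Lambda m i j = level_sum m 0 i j.
Proof. by rewrite /Lambda (@gen_poly_path_sum _ j) // -path_sum_level. Qed.

(* The rows of [B] arise from those of [A] by a bidiagonal matrix. Expanding
   row by row leaves minors of [A] whose row indices lie in {r a - 1, r a},
   hence are weakly increasing; a repetition makes the minor vanish. *)
Lemma bidiagonal_minor_nonneg (A B : nat -> nat -> Zalpha) (w : nat -> Zalpha)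
    (n : nat) (r c : 'I_n -> nat) :
  (forall i, coefwise_nonneg (w i)) ->
  (forall j, B 0%N j = A 0%N j) ->
  (forall i j, B i.+1 j = A i.+1 j + w i * A i j) ->
  (forall f : 'I_n -> nat, {homo f : a b / (a < b)%N} ->
     coefwise_nonneg (\det (\matrix_(a < n, b < n) A (f a) (c b)))) ->
  {homo r : a b / (a < b)%N} ->
  coefwise_nonneg (\det (\matrix_(a < n, b < n) B (r a) (c b))).
Proof.
move=> w_ge0 B0 BS A_ge0 r_inc.
(* Hybrid matrices lead from the minor of [B] at [k = n] to minors of [A] at [k = 0], one row at a
   time. *)
pose M k (f : 'I_n -> nat) :=
  \matrix_(a < n, b < n) (if (a < k)%N then B (r a) (c b) else A (f a) (c b)).
suff M_ge0 k f : (k <= n)%N -> (forall a, (r a).-1 <= f a <= r a)%N ->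
    coefwise_nonneg (\det (M k f)).
  suff -> : \matrix_(a < n, b < n) B (r a) (c b) = M n r.
    by apply: M_ge0 => // a; rewrite leq_pred leqnn.
  by apply/matrixP => a b; rewrite !mxE ltn_ord.
elim: k f => [|k IHk] f le_kn fr.
  have -> : M 0%N f = \matrix_(a < n, b < n) A (f a) (c b).
    by apply/matrixP => a b; rewrite !mxE.
  have [/forallP f_inc|] :=
    boolP [forall a : 'I_n, [forall b : 'I_n, (a < b)%N ==> (f a < f b)%N]].
    by apply: A_ge0 => a b; have /forallP/(_ b)/implyP := f_inc a; apply.
  rewrite negb_forall => /existsP[a]; rewrite negb_forall => /existsP[b].
  rewrite negb_imply -leqNgt => /andP[lt_ab le_fba].
  (* [f a <= r a <= (r b).-1 <= f b], so a failure of strict growth is an equality. *)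
  have eq_fab : f a = f b.
    by have := r_inc _ _ lt_ab; have := fr a; have := fr b; lia.
  rewrite (@determinant_alternate _ _ _ a b) ?neq_ltn ?lt_ab //.
    exact: coefwise_nonneg0.
  by move=> d; rewrite !mxE eq_fab.
pose a0 := Ordinal le_kn.
pose upd v a := if a == a0 then v else f a.
have upd_ok v : ((r a0).-1 <= v <= r a0)%N ->
    coefwise_nonneg (\det (M k (upd v))).
  move=> vr; apply: IHk => [|a]; first exact: ltnW.
  by rewrite /upd; case: eqP => [->|].
have row_upd v : row' a0 (M k (upd v)) = row' a0 (M k.+1 f).
  apply/matrixP => a b; rewrite !mxE /upd.
  rewrite [lift _ _ == _]eq_sym (negPf (neq_lift _ _)).
  by have -> : (lift a0 a < k.+1)%N = (lift a0 a < k)%N by rewrite /= /bump; lia.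
have rowM v b : M k (upd v) a0 b = A v (c b).
  by rewrite mxE ltnn /upd eqxx.
have rowM1 b : M k.+1 f a0 b = B (r a0) (c b) by rewrite mxE leqnn.
(* Row 0 of [B] is simply replaced by that of [A]; a row [i.+1] is split by multilinearity, choosing
   [i.+1] with coefficient 1 or [i] with coefficient [w i]. *)
case r0 : (r a0) => [|i].
  suff -> : M k.+1 f = M k (upd 0%N) by apply: upd_ok; rewrite r0.
  apply/matrixP => a b; case: (unliftP a0 a) => [a'|] ->; last first.
    by rewrite rowM rowM1 r0.
  by have /matrixP/(_ a' b) := row_upd 0%N; rewrite ![row' _ _ _ _]mxE.
rewrite (@determinant_multilinear _ _ _ (M k (upd i.+1)) (M k (upd i)) a0 1 (w i)).
- rewrite mul1r; apply: coefwise_nonnegD; last apply: coefwise_nonnegM => //.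
    by apply: upd_ok; rewrite r0 /=; lia.
  by apply: upd_ok; rewrite r0 /=; lia.
- apply/rowP => b; rewrite [LHS]mxE rowM1 [RHS]mxE.
  rewrite [X in _ = X + _]mxE [X in _ = _ + X]mxE mul1r.
  rewrite [X in _ = X + _]mxE [X in _ = _ + _ * X]mxE !rowM r0.
  exact: BS.
- by rewrite row_upd.
- by rewrite row_upd.
Qed.

(** The bound [N] is strict, so that [N = 0] leaves only the empty minor; [s] must vary in the
    induction, since lowering the columns by one passes to [s.+1]. *)
Lemma level_sum_minor_nonneg (m N s n : nat) (r c : 'I_n -> nat) :
  {homo r : a b / (a < b)%N} -> {homo c : a b / (a < b)%N} ->
  (forall a, c a < N)%N ->
  coefwise_nonneg (\det (\matrix_(a < n, b < n) level_sum m s (r a) (c b))).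
Proof.
elim: N s n r c => [|N IHN] s n r c r_inc c_inc c_lt.
  case: n => [|n] in r c r_inc c_inc c_lt *; last by have := c_lt ord0.
  by rewrite det_mx00; apply: (coefwise_nonneg_nat 1).
(* The size is left free: this serves both for the whole minor and for the cofactor of its
   corner. *)
have positive_columns n' (r' c' : 'I_n' -> nat) :
    {homo r' : a b / (a < b)%N} -> {homo c' : a b / (a < b)%N} ->
    (forall a, 0 < c' a < N.+1)%N ->
    coefwise_nonneg (\det (\matrix_(a, b) level_sum m s (r' a) (c' b))).
  move=> r'_inc c'_inc c'_bd.
  have := @bidiagonal_minor_nonneg (fun i j => level_sum m s.+1 i j)
    (fun i j => level_sum m s i j.+1) (fun i => alpha m (s + m.+1 * i.+1)%N)
    n' r' (fun a => (c' a).-1).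
  have -> : \matrix_(a, b) level_sum m s (r' a) (c' b).-1.+1
          = \matrix_(a, b) level_sum m s (r' a) (c' b).
    by apply/matrixP => a b; rewrite !mxE prednK //; case/andP: (c'_bd b).
  apply=> // [i|j|f f_inc]; first exact: coefwise_nonneg_alpha.
    by rewrite /= addr0.
  apply: IHN => // [a b|a]; last by have := c'_bd a; lia.
  by move/c'_inc; have := c'_bd a; lia.
case: n => [|n] in r c r_inc c_inc c_lt *.
  by rewrite det_mx00; apply: (coefwise_nonneg_nat 1).
have [c0|c0_gt0] := posnP (c ord0); last first.
  apply: positive_columns => // a; rewrite c_lt andbT.
  have [->//|a_gt0] := eqVneq a ord0.
  by apply: ltn_trans c0_gt0 (c_inc _ _ _); rewrite lt0n.
(* As [r] is strictly increasing, only the top row can meet row 0, where column 0 has its sole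
   nonzero entry; the corner's cofactor has sign +1. *)
rewrite (expand_det_col _ ord0) big_ord_recl big1 ?addr0 => [|a _].
  rewrite mxE c0 /= /cofactor addn0 expr0 mul1r.
  apply: coefwise_nonnegM; first exact: coefwise_nonneg_nat.
  have -> : row' ord0 (col' ord0 (\matrix_(a, b) level_sum m s (r a) (c b)))
    = \matrix_(a, b) level_sum m s (r (lift ord0 a)) (c (lift ord0 b)).
    by apply/matrixP => a b; rewrite !mxE.
  apply: positive_columns => [a b lt_ab|a b lt_ab|a].
  - by apply: r_inc; rewrite /= !/bump.
  - by apply: c_inc; rewrite /= !/bump.
  - by rewrite c_lt andbT; apply: leq_ltn_trans (c_inc ord0 _ _).
rewrite mxE c0 /= gtn_eqF ?mul0r //.
by apply: leq_ltn_trans (r_inc ord0 _ _).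
Qed.

Theorem proposition3p2 (m : nat) (hm : (0 < m)%N) : totally_positive (Lambda m).
Proof.
move=> n r c r_inc c_inc.
have -> : \matrix_(a < n, b < n) Lambda m (r a) (c b)
        = \matrix_(a < n, b < n) level_sum m 0 (r a) (c b).
  by apply/matrixP => a b; rewrite !mxE Lambda_level_sum.
apply: (@level_sum_minor_nonneg _ (\max_a c a).+1) => // a.
by rewrite ltnS leq_bigmax.
Qed.
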